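(* Let $k$ be a positive integer, and let $g_k\in \mathrm{H}_2$ be the element with trivial shift which interchanges $-j$ and $j$ for every $1\le j\le k$ and whose permutation part fixes all other nonzero integers, i.e. $g_k=\big((-k,k)(-(k-1),k-1)\cdots(-2,2)(-1,1)\big)_0$. Then $g_k$ is a dead end of depth at least $k$ in the Houghton group $\mathrm{H}_2$ with respect to the generating set $X=\{s,\sigma\}$.
   Context: The Houghton group $\mathrm{H}_2$: let $*^2=\{(k,l) : k\in\mathbb{N},\ l\in\{1,2\}\}$ with $\mathbb{N}=\{0,1,2,\dots\}$. $\mathrm{H}_2$ is the group of all permutations $\phi$ of $*^2$ for which there exist constants $s(1),s(2)\in\mathbb{Z}$ such that $\phi(k,l)=(k+s(l),l)$ for all but finitely many $(k,l)$. Points of $*^2$ are labelled by nonzero integers: $(j-1,1)$ is labelled $-j$ and $(j-1,2)$ is labelled $j$, for $j\ge1$; so $\mathrm{H}_2$ acts on $\mathbb{Z}\setminus\{0\}$. The generator $s\in \mathrm{H}_2$ is the shift by one step to the right along the nonzero integers: $s(k,1)=(k-1,1)$ for $k\ge1$, $s(0,1)=(0,2)$, $s(k,2)=(k+1,2)$; in labels, $s(-1)=1$ and $s(i)=i+1$ for $i\ne -1$. The generator $\sigma$ is the transposition interchanging $(0,1)$ and $(0,2)$, i.e. $-1$ and $1$. The set $X=\{s,\sigma\}$ generates $\mathrm{H}_2$. Every element of $\mathrm{H}_2$ is written uniquely as $(\omega)_t$, meaning a finitely supported permutation $\omega$ of $\mathbb{Z}\setminus\{0\}$ followed by the shift $s^t$,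 $t\in\mathbb{Z}$; ''trivial shift'' means $t=0$. Dead ends: for a group $G$ with finite generating set $X$, the Cayley graph has vertex set $G$ and edges the pairs $(g_1,g_2)$ with $g_1^{-1}g_2\in X^{\pm1}$, and $d=d_X$ is the resulting path (word) metric. $B_g(r)=\{h\in G: d(g,h)\le r\}$. An element $g$ with $n=d(1,g)$ is a dead end with respect to $X$ if $B_g(1)\subseteq B_1(n)$; its depth is $\max\{l : B_g(l)\subseteq B_1(n)\}$.
   Formalization: The formal theorem assumes k ≥ 2 instead of k ≥ 1: for k = 1 the claim is false, since g_1 = σ has length 1 while its neighbour σs has length 2, so g_1 is not a dead end. *)

(* Defs.v *)
From HB Require Import structures.
From mathcomp Require Import all_boot all_order all_algebra.
From mathcomp Require Import mathcomp_extra boolp classical_sets cardinality.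

Set Implicit Arguments.
Unset Strict Implicit.
Unset Printing Implicit Defensive.

Import GRing.Theory Num.Theory.
Local Open Scope classical_set_scope.
Local Open Scope group_scope.

Section CayleyGraph.
Variables (G : groupType) (X : seq G).
Implicit Types (g h : G) (n r l : nat).

Definition cayley_edge : rel G :=
  fun g h => let x := g^-1 * h in (x \in X) || (x^-1 \in X).

Definition cayley_walk g h n : Prop :=
  exists p : seq G, [/\ path cayley_edge g p, last g p = h & size p = n].

(* The word metric d(g, h) = n, as a relation: it holds for no n when h cannot
   be reached from g, i.e. d(g, h) is then infinite. *)
Definition cayley_dist g h n : Prop :=
  cayley_walk g h n /\ forall m, cayley_walk g h m -> (n <= m)%N.

Definition cayley_ball g r : set G :=
  [set h | exists2 n, cayley_dist g h n & (n <= r)%N].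

Definition dead_end g : Prop :=
  exists2 n, cayley_dist 1 g n & cayley_ball g 1 `<=` cayley_ball 1 n.

Definition depth_is g l : Prop :=
  exists n, [/\ cayley_dist 1 g n, cayley_ball g l `<=` cayley_ball 1 n &
    forall l', cayley_ball g l' `<=` cayley_ball 1 n -> (l' <= l)%N].

End CayleyGraph.

(* The points (k, l) of two copies of N; [false] stands for the ray l = 1 and
   [true] for the ray l = 2. *)
Notation point := (nat * bool)%type.

Definition translates_by (f : point -> point) (t : bool -> int) (p : point) :
    Prop :=
  (f p).2 = p.2 /\ ((f p).1%:Z = p.1%:Z + t p.2)%R.

Definition almost_translation (f : point -> point) : Prop :=
  exists t : bool -> int, cofinite_set [set p | translates_by f t p].

(* The inverse is a field so that the group structure is explicit; it is
   determined by [h2_fun] (see [h2P]). *)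
Record H2 := MkH2 {
  h2_fun :> point -> point;
  h2_inv : point -> point;
  h2K : cancel h2_fun h2_inv;
  h2VK : cancel h2_inv h2_fun;
  h2_almost : almost_translation h2_fun
}.

Lemma h2P (f g : H2) : h2_fun f =1 h2_fun g -> f = g.
Proof.
case: f g => [f f' fK f'K Af] [g g' gK g'K Ag] /= /funext fg.
have f'g' : f' = g'.
  by apply/funext => x; rewrite -{1}(g'K x) -fg fK.
by case: _ / fg in gK g'K Ag *; case: _ / f'g' in gK g'K *; congr MkH2.
Qed.

HB.instance Definition _ := gen_eqMixin H2.
HB.instance Definition _ := gen_choiceMixin H2.

Lemma almost_translation_fin (f : point -> point) (s : seq point) :
  (forall p, p \notin s -> f p = p) -> almost_translation f.
Proof.
move=> fs; exists (fun=> 0%R); apply: sub_finite_set (finite_seq s) => p /=.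
apply: contra_notP => /negP/fs fp; rewrite /translates_by fp; split=> //.
by rewrite addr0.
Qed.

Lemma almost_translation_comp (f g : point -> point) : injective f ->
  almost_translation f -> almost_translation g -> almost_translation (g \o f).
Proof.
move=> finj [t Ft] [u Fu]; exists (fun l => (t l + u l)%R).
have Fu' := finite_preimage (in2W finj) Fu.
suff: ~` [set p | translates_by (g \o f) (fun l => (t l + u l)%R) p] `<=`
    ~` [set p | translates_by f t p] `|` f @^-1` ~` [set p | translates_by g u p].
  by move/sub_finite_set; apply; rewrite finite_setU.
move=> p /= nT; apply: contrapT => /not_orP[/= /contrapT[f2 f1] /contrapT[g2 g1]].
by apply: nT; rewrite /translates_by /= g2 g1 f1 f2 addrA.
Qed.

Lemma almost_translation_inv (f f' : point -> point) :
  cancel f f' -> cancel f' f -> almost_translation f -> almost_translation f'.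
Proof.
move=> fK f'K [t Ft]; exists (fun l => - t l)%R.
apply: sub_finite_set (finite_image f Ft) => p /= nT; exists (f' p) => //.
move=> [f2 f1]; apply: nT; rewrite !f'K in f1 f2.
by rewrite /translates_by f1 f2 addrK.
Qed.

Definition h2_one : H2 :=
  @MkH2 id id (frefl _) (frefl _)
    (@almost_translation_fin id [::] (fun _ _ => erefl)).

Definition h2_invg (f : H2) : H2 :=
  MkH2 (h2VK f) (h2K f) (almost_translation_inv (h2K f) (h2VK f) (h2_almost f)).

(* As for [perm_type], [f * g] is [f] followed by [g]. *)
Definition h2_mul (f g : H2) : H2 :=
  MkH2 (can_comp (h2K g) (h2K f)) (can_comp (h2VK f) (h2VK g))
    (almost_translation_comp (can_inj (h2K f)) (h2_almost f) (h2_almost g)).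

Lemma h2_mulA : associative h2_mul.
Proof. by move=> f g h; apply: h2P. Qed.

Lemma h2_mul1 : left_id h2_one h2_mul.
Proof. by move=> f; apply: h2P. Qed.

Lemma h2_mulr1 : right_id h2_one h2_mul.
Proof. by move=> f; apply: h2P. Qed.

Lemma h2_mulV : left_inverse h2_one h2_invg h2_mul.
Proof. by move=> f; apply: h2P => p /=; exact: h2VK. Qed.

Lemma h2_mulrV : right_inverse h2_one h2_invg h2_mul.
Proof. by move=> f; apply: h2P => p /=; exact: h2K. Qed.

HB.instance Definition _ :=
  isGroup.Build H2 h2_mulA h2_mul1 h2_mulr1 h2_mulV h2_mulrV.

(* The labelling of the points by nonzero integers. *)
Definition label (p : point) : int :=
  (if p.2 then p.1.+1%:Z else - p.1.+1%:Z)%R.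

Definition shift_fun (p : point) : point :=
  match p.2, p.1 with
  | false, k.+1 => (k, false)
  | false, 0 => (0, true)
  | true, k => (k.+1, true)
  end.

Definition shift_inv (p : point) : point :=
  match p.2, p.1 with
  | false, k => (k.+1, false)
  | true, 0 => (0, false)
  | true, k.+1 => (k, true)
  end.

Lemma shift_funK : cancel shift_fun shift_inv.
Proof. by case=> [[|k] []]. Qed.

Lemma shift_invK : cancel shift_inv shift_fun.
Proof. by case=> [[|k] []]. Qed.

Lemma shift_almost : almost_translation shift_fun.
Proof.
exists (fun l => if l then 1%R else (-1)%R).
apply: sub_finite_set (finite_set1 (0, false)) => -[k l] /= nT.
suff /eqP : (k, l) == (0, false) by [].
apply: contra_notT nT; rewrite /translates_by.
by case: k l => [|k] [] //= _; split=> //; rewrite -addn1 PoszD ?addrK.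
Qed.

Definition h2_s : H2 := MkH2 shift_funK shift_invK shift_almost.

(* In labels, the product of the transpositions (-j, j) for 1 <= j <= k. *)
Definition flip_fun (k : nat) (p : point) : point :=
  if (p.1 < k)%N then (p.1, ~~ p.2) else p.

Lemma flip_funK (k : nat) : involutive (flip_fun k).
Proof.
by case=> i l; rewrite /flip_fun /=; case ik: (i < k)%N; rewrite /= ik ?negbK.
Qed.

Lemma flip_almost (k : nat) : almost_translation (flip_fun k).
Proof.
apply: (@almost_translation_fin _ [seq (i, l) | i <- iota 0 k, l <- [:: true; false]]).
move=> [i l]; rewrite /flip_fun; case: ifP => // ik /negP[].
by apply/allpairsPdep; exists i, l; rewrite mem_iota ik; split=> //; case: (l).
Qed.

Definition h2_flip (k : nat) : H2 :=
  MkH2 (flip_funK k) (flip_funK k) (flip_almost k).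

(* The transposition of the points labelled -1 and 1. *)
Definition sigma_fun (p : point) : point :=
  match p with
  | (0, l) => (0, ~~ l)
  | (_.+1, _) => p
  end.

Lemma sigma_funK : involutive sigma_fun.
Proof. by case=> [[|k] []]. Qed.

Lemma sigma_almost : almost_translation sigma_fun.
Proof.
apply: (@almost_translation_fin _ [:: (0, false); (0, true)]).
by case=> [[|k] []].
Qed.

Definition h2_sigma : H2 := MkH2 sigma_funK sigma_funK sigma_almost.

Definition h2_gens : seq H2 := [:: h2_s; h2_sigma].

Lemma label_s (p : point) :
  label (h2_s p) = (if label p == -1 then 1 else label p + 1)%R.
Proof.
case: p => [[|k] []] //=; rewrite /label /=; first by rewrite -addn1 PoszD.
by rewrite -[k.+2]addn1 PoszD opprD addrNK.
Qed.

Lemma label_sigma (p : point) :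
  label (h2_sigma p) = (if `|label p| == 1 then - label p else label p)%R.
Proof.
by case: p => [[|k] []] //=; rewrite /label /= ?normrN ?opprK.
Qed.

Lemma label_flip (k : nat) (p : point) :
  label (h2_flip k p) = (if `|label p| <= k%:Z then - label p else label p)%R.
Proof.
case: p => i l; have -> : `|label (i, l)|%R = Posz i.+1.
  by rewrite /label /=; case: l; rewrite ?normrN.
rewrite lez_nat /= /flip_fun /=; case: ifP => // _.
by rewrite /label /=; case: l; rewrite ?opprK.
Qed.

Lemma h2_flip1 : h2_flip 1 = h2_sigma.
Proof. by apply: h2P => -[[|k] l]. Qed.

Lemma cayley_ballP (G : groupType) (X : seq G) (g h : G) (r : nat) :
  cayley_ball X g r h <-> exists2 n, cayley_walk X g h n & (n <= r)%N.
Proof.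
split=> [[n [W _] nr]|[n W nr]]; first by exists n.
have exW : exists m, `[< cayley_walk X g h m >] by exists n; apply/asboolP.
have [m /asboolP Wm minm] := ex_minnP exW.
exists m; last by apply: leq_trans nr; apply/minm/asboolP.
by split=> // m' /asboolP; apply: minm.
Qed.

(* The theorem on dead ends needs k > 1: for k = 1 the element is sigma itself,
   of length 1, while sigma * s has length 2. *)
Lemma h2_flip1_not_dead_end : ~ dead_end h2_gens (h2_flip 1).
Proof.
rewrite h2_flip1 => -[n [_ minn] sub].
have n1 : (n <= 1)%N.
  apply: minn; exists [:: h2_sigma]; split=> //=.
  by rewrite /cayley_edge /h2_gens !inE invg1 mul1g eqxx !orbT.
have /sub/cayley_ballP[m [p [pp lp sp]] mn] :
    cayley_ball h2_gens h2_sigma 1 (h2_sigma * h2_s).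
  apply/cayley_ballP; exists 1%N => //; exists [:: h2_sigma * h2_s]; split=> //=.
  by rewrite /cayley_edge /h2_gens !inE mulKg eqxx.
have ne (f : H2) (x : point) : h2_sigma * h2_s = f -> shift_fun (sigma_fun x) = f x.
  by move=> /(congr1 (@h2_fun ^~ x)).
case: p pp lp sp => [_ lp _|h [|h' p]].
- by have := ne _ (0, false) (esym lp).
- move=> hE lhE _; move: hE lhE; rewrite [path _ _ _]/= [last _ _]/= andbT.
  rewrite /cayley_edge invg1 mul1g => /[swap] -> /orP[].
    by rewrite !inE => /orP[] /eqP E; [have := ne _ (0, true) E
      | have := ne _ (1%N, true) E].
  rewrite !inE => /orP[] /eqP /(canRL invgK) E.
  + by have := ne _ (1%N, true) E.
  + by have := ne _ (1%N, true) E.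
by move=> _ _ sp; move: (leq_trans mn n1); rewrite -sp.
Qed.

(* Main.v *)
Require Import Defs.
From mathcomp Require Import all_boot.
From mathcomp Require Import all_order all_algebra.
From mathcomp Require Import boolp.
From mathcomp Require Import zify.

(** Read an element of the group as an arrangement of items on a two-way
infinite tape. The points are numbered by all integers, 0, 1, 2, ... on one ray
and -1, -2, ... on the other, and [f] puts the item [p] into the cell
[coord (f p)]. A cursor sits between the cells -1 and 0. Multiplying on the right
by [h2_sigma] swaps the two items beside the cursor, and multiplying by [h2_s]
moves the tape one cell to the right, that is, the cursor one cell to the left
along the items. The word length of [f] is thus the least number of cursor steps
and swaps that produce the arrangement [f] and bring the cursor to its final
place. The flip [h2_flip k] reverses a block of 2k consecutive items, with the
cursor back in the middle.

With N = k(2k-1), the number of pairs of items in the block, the flip has length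
exactly 2N + k - 2 = 4k^2 - k - 2, and no element at distance at most k from it
is longer. That gives depth at least k.

Upper bound ([near_flip]). A word of at most k letters after the flip only
rearranges the block and leaves the cursor at some signed distance t from the
middle, with |t| <= k, because a swap at the very edge of the block needs more
letters. Every such arrangement can be undone cheaply: bring the cursor to
the nearest end of the block, sweep it to the other end while dragging the item
that belongs there, and come back while dragging the item that belongs at this
end. The block shrinks by one item at each end and the cursor is ready for the next
round. On the way the cursor visits N gaps, with at most one swap in
each, so that the rounds cost at most 2N - 1 letters ([collapse]). Reaching the
end gap costs k - 1 - |t| letters, or one letter when |t| = k; this last case is
where k > 1 matters.

Lower bound ([trail_flip_lower]). Two quantities are followed along a word
([trail_potential]). The number of inversions of the block changes only at swaps,
by at most one, and it must reach N. The signed number of times that the cursor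
has moved past a given item does not depend on the word: it is the change of
[level], corrected by the net shift. A swap leaves all these numbers unchanged,
and a cursor step changes exactly one of them by one. Since the outermost item
of the block has to leave its place, the cursor must at some time reach the
leftmost gap of the block; stop at the first such time, with m = k - 1.
All other items of the block are then to the right of the cursor, in distinct
cells. The inner 2m items have to be passed, before and after this time together,
at least twice the sum of the absolute values of 2m distinct integers, hence at
least 2m^2 times, and the two extreme items at least 2m times each. So there are
at least 2m^2 + 4m = 2k^2 - 2 cursor steps, besides at least N swaps. *)

Import Order.TTheory GRing.Theory Num.Theory.
Set Implicit Arguments.
Unset Strict Implicit.
Unset Printing Implicit Defensive.
Local Open Scope group_scope.
Bind Scope group_scope with H2.

(** * Points of the two rays as integers *)

Definition coord (p : point) : int := if p.2 then Posz p.1 else Negz p.1.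

Definition of_coord (z : int) : point :=
  match z with Posz i => (i, true) | Negz i => (i, false) end.

Lemma of_coordK : cancel of_coord coord.
Proof. by case. Qed.

Lemma coordK : cancel coord of_coord.
Proof. by case=> i []. Qed.

Lemma coordE i b : coord (i, b) = (if b then i%:Z else - i%:Z - 1)%R.
Proof. by case: b; rewrite // /coord [LHS]NegzE -addn1 PoszD opprD. Qed.

Lemma coord_inj : injective coord.
Proof. exact: can_inj coordK. Qed.

Lemma coord_shift p : coord (shift_fun p) = (coord p + 1)%R.
Proof. by case: p => [[|i] []]; rewrite [shift_fun _]/= !coordE ?[fst _]/=; lia. Qed.

Lemma coord_unshift p : coord (shift_inv p) = (coord p - 1)%R.
Proof. by rewrite -{2}(shift_invK p) coord_shift addrK. Qed.

Lemma coord_sigma p : coord (sigma_fun p) =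
  (if (coord p == -1) || (coord p == 0) then -1 - coord p else coord p)%R.
Proof. by case: p => [[|i] []]. Qed.

Lemma coord_flip k p : coord (flip_fun k p) =
  (if (- k%:Z <= coord p < k%:Z)%R then -1 - coord p else coord p)%R.
Proof.
case: p => i b; rewrite /flip_fun [fst _]/= [snd _]/= fun_if !coordE.
by case: (ltnP i k); case: b => ik; case: ifP; rewrite ?[~~ _]/= ?coordE; lia.
Qed.

Lemma h2_inj (f : H2) : injective f.
Proof. exact: can_inj (h2K f). Qed.

(** * Words in the generators and their net shift *)

(** Walks in the Cayley graph from [g], indexed by the exponent sum [t] of the shift,
which tells where the cursor is relative to its place in [g]; induction on walks
then needs no separate shift homomorphism. *)
Inductive trail (g : H2) : H2 -> int -> nat -> Prop :=
| trail_nil : trail g g 0%R 0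
| trail_s h t n : trail g h t n -> trail g (h * h2_s) (t + 1)%R n.+1
| trail_sV h t n : trail g h t n -> trail g (h * h2_s^-1) (t - 1)%R n.+1
| trail_sigma h t n : trail g h t n -> trail g (h * h2_sigma) t n.+1.

Lemma sigmaV : h2_sigma^-1 = h2_sigma.
Proof. exact: h2P. Qed.

Lemma trail_cat f g h t u m n :
  trail f g t m -> trail g h u n -> trail f h (t + u)%R (m + n).
Proof.
move=> fg; elim=> [|h' u' n' _ IH|h' u' n' _ IH|h' u' n' _ IH].
- by rewrite addr0 addn0.
- by rewrite addrA addnS; exact: trail_s.
- by rewrite addrA addnS; exact: trail_sV.
- by rewrite addnS; exact: trail_sigma.
Qed.

Lemma cayley_edgeP (g h : H2) : cayley_edge h2_gens g h <->
  [\/ h = g * h2_s, h = g * h2_s^-1 | h = g * h2_sigma].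
Proof.
rewrite /cayley_edge /h2_gens !inE; split.
  case/orP=> /orP[] /eqP.
  - by move/(canRL (mulVKg g)); constructor 1.
  - by move/(canRL (mulVKg g)); constructor 3.
  - by move/(canRL invgK)/(canRL (mulVKg g)); constructor 2.
  - by move/(canRL invgK)/(canRL (mulVKg g)); rewrite sigmaV; constructor 3.
by case=> ->; rewrite mulKg ?invgK eqxx ?orbT.
Qed.

Lemma cayley_walkP (g h : H2) n :
  cayley_walk h2_gens g h n <-> exists t, trail g h t n.
Proof.
split=> [[p [+ + <-]]|[t]].
  elim/last_ind: p h => [|p x IH] h /=; first by move=> _ <-; exists 0%R; constructor.
  rewrite rcons_path last_rcons size_rcons => /andP[gp px] <-.
  have [t gt] := IH _ gp erefl.
  by case/cayley_edgeP: px => ->; eexists; [exact: trail_s gt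
    | exact: trail_sV gt | exact: trail_sigma gt].
have ext h' p x : path (cayley_edge h2_gens) g p -> last g p = h' ->
    cayley_edge h2_gens h' x -> cayley_walk h2_gens g x (size p).+1.
  move=> gp <- px; exists (rcons p x).
  by rewrite rcons_path last_rcons size_rcons gp.
elim=> [|h' u m _|h' u m _|h' u m _]; first by exists [::].
all: by move=> [p [gp gl <-]]; apply: ext gp gl _; apply/cayley_edgeP;
  by [constructor 1 | constructor 2 | constructor 3].
Qed.

Lemma trail_rev g h t n : trail g h t n -> trail h g (- t)%R n.
Proof.
elim=> [|h' u m _ IH|h' u m _ IH|h' u m _ IH]; first by rewrite oppr0; constructor.
- have := trail_sV (trail_nil (h' * h2_s)).
  by rewrite mulgK add0r opprD addrC => /trail_cat; apply.
- have := trail_s (trail_nil (h' * h2_s^-1)).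
  by rewrite mulgVK add0r opprD opprK addrC => /trail_cat; apply.
- have := trail_sigma (trail_nil (h' * h2_sigma)).
  by rewrite -{3}sigmaV mulgK -(add0r (- u)%R) => /trail_cat; apply.
Qed.

(** Each generator moves every point by at most one; so far translations of one
point force long words. *)
Lemma trail_dist g h t n p : trail g h t n ->
  (`|coord (h p) - coord (g p)| <= n%:Z)%R.
Proof.
elim=> [|h' u m _|h' u m _|h' u m _] /=; first lia.
- by rewrite coord_shift; lia.
- by rewrite coord_unshift; lia.
- by rewrite coord_sigma; case: ifP; lia.
Qed.

(** * The distance and the reflection of the tape *)

Definition near (f g : H2) n := exists t m, trail f g t m /\ (m <= n)%N.

Lemma ballP f g n : cayley_ball h2_gens f n g <-> near f g n.
Proof.
split=> [/cayley_ballP[m /cayley_walkP[t fg] mn]|[t [m [fg mn]]]].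
  by exists t, m.
by apply/cayley_ballP; exists m => //; apply/cayley_walkP; exists t.
Qed.

Lemma near_refl f n : near f f n.
Proof. by exists 0%R, 0%N; split=> //; constructor. Qed.

Lemma near_trans f g h m n : near f g m -> near g h n -> near f h (m + n).
Proof.
move=> [t [m' [fg mm]]] [u [n' [gh nn]]]; exists (t + u)%R, (m' + n')%N.
by split; [exact: trail_cat gh | exact: leq_add].
Qed.

Lemma near_leq f g m n : (m <= n)%N -> near f g m -> near f g n.
Proof. by move=> mn [t [m' [fg mm]]]; exists t, m'; rewrite (leq_trans mm). Qed.

Lemma near_sym f g n : near f g n -> near g f n.
Proof. by move=> [t [m [fg mn]]]; exists (- t)%R, m; split=> //; exact: trail_rev. Qed.

Lemma near_s f : near f (f * h2_s) 1.
Proof. by exists (0 + 1)%R, 1%N; split=> //; do 2!constructor. Qed.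

Lemma near_sV f : near f (f * h2_s^-1) 1.
Proof. by exists (0 - 1)%R, 1%N; split=> //; apply: trail_sV; constructor. Qed.

Lemma near_sigma f : near f (f * h2_sigma) 1.
Proof. by exists 0%R, 1%N; split=> //; do 2!constructor. Qed.

(** Exchanging the two rays normalizes the group, inverts the shift and fixes the
transposition; hence it preserves distances, and everything proved about sweeps to
the right holds for sweeps to the left. *)
Definition swap_sides (p : point) : point := (p.1, ~~ p.2).

Lemma swap_sidesK : involutive swap_sides.
Proof. by case=> i b; rewrite /swap_sides /= negbK. Qed.

Lemma coord_swap_sides p : coord (swap_sides p) = (-1 - coord p)%R.
Proof. by case: p => i b; rewrite !coordE /=; case: b => /=; lia. Qed.

Definition conj_swap (f : point -> point) := swap_sides \o f \o swap_sides.

Lemma conj_swapK f g : cancel f g -> cancel (conj_swap f) (conj_swap g).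
Proof. by move=> fK p; rewrite /conj_swap /= swap_sidesK fK swap_sidesK. Qed.

Lemma conj_swap_almost f : almost_translation f -> almost_translation (conj_swap f).
Proof.
move=> [t ft]; exists (fun b => t (~~ b)).
apply: cardinality.sub_finite_set (cardinality.finite_image swap_sides ft) => p /= nT.
exists (swap_sides p); last exact: swap_sidesK.
move=> [f2 f1]; apply: nT; split; first by rewrite /conj_swap /= f2 negbK.
by rewrite /conj_swap /= f1.
Qed.

Definition mirror (f : H2) : H2 :=
  MkH2 (conj_swapK (h2K f)) (conj_swapK (h2VK f)) (conj_swap_almost (h2_almost f)).

Lemma mirrorK : involutive mirror.
Proof.
by move=> f; apply: h2P => p; rewrite /= /conj_swap /= swap_sidesK swap_sidesK.
Qed.

Lemma mirrorM f g : mirror (f * g) = mirror f * mirror g.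
Proof. by apply: h2P => p /=; rewrite /conj_swap /= swap_sidesK. Qed.

Lemma mirror1 : mirror 1 = 1.
Proof. by apply: h2P => p /=; exact: swap_sidesK. Qed.

Lemma mirror_s : mirror h2_s = h2_s^-1.
Proof. by apply: h2P => -[[|i] []]. Qed.

Lemma mirror_sV : mirror h2_s^-1 = h2_s.
Proof. by rewrite -mirror_s mirrorK. Qed.

Lemma mirror_sigma : mirror h2_sigma = h2_sigma.
Proof. by apply: h2P => -[[|i] []]. Qed.

Lemma near_mirror f g n : near f g n -> near (mirror f) (mirror g) n.
Proof.
move=> [t [m [fg mn]]]; exists (- t)%R, m; split=> // {mn}.
elim: fg => [|h u r _|h u r _|h u r _]; first by rewrite oppr0; constructor.
- by rewrite mirrorM mirror_s opprD; exact: trail_sV.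
- by rewrite mirrorM mirror_sV opprD opprK; exact: trail_s.
- by rewrite mirrorM mirror_sigma; exact: trail_sigma.
Qed.

(** * Sorting a block by sweeps of the cursor *)

(** The arrangements that occur while the block of the items with coordinates from
[a] to [b - 1] is being sorted. These items fill the cells from a + t to b + t - 1,
so that the cursor is strictly inside the block exactly when a + t < 0 < b + t. *)
Definition framed (a b t : int) (f : H2) : Prop := forall p,
  ((coord p < a) || (b <= coord p))%R -> coord (f p) = (coord p + t)%R.

Lemma framed_inside a b t f p : framed a b t f ->
  (a <= coord p < b)%R -> (a + t <= coord (f p) < b + t)%R.
Proof.
move=> ff pab; apply: contraT => out.
have := ff (of_coord (coord (f p) - t)%R); rewrite of_coordK subrK => fq.
have /coord_inj/(@h2_inj f) pq := fq ltac:(lia).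
by move: (congr1 coord pq); rewrite of_coordK; lia.
Qed.

Lemma framed_s a b t f : framed a b t f -> framed a b (t + 1) (f * h2_s).
Proof. by move=> ff p /ff /= fp; rewrite coord_shift fp addrA. Qed.

Lemma framed_sV a b t f : framed a b t f -> framed a b (t - 1) (f * h2_s^-1).
Proof. by move=> ff p /ff /= fp; rewrite coord_unshift fp addrA. Qed.

Lemma framed_sigma a b t f : (a + t < 0 < b + t)%R -> framed a b t f ->
  framed a b t (f * h2_sigma).
Proof.
move=> abt ff p pab; have /= fp := ff _ pab.
by rewrite coord_sigma fp; case: ifP => //; lia.
Qed.

Lemma framed_mirror a b t f : framed a b t f -> framed (- b) (- a) (- t) (mirror f).
Proof.
move=> ff p pab; rewrite /= /conj_swap /= coord_swap_sides ff coord_swap_sides; lia.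
Qed.

(** An item that is not to the right of the cursor here is in the cell just to its
left, and one swap brings it to the other side. *)
Lemma swap_right a b t f x : (a + t < 0 < b + t)%R -> framed a b t f ->
  (-1 <= coord (f x))%R ->
  exists g : H2, [/\ framed a b t g, (0 <= coord (g x))%R & near f g 1].
Proof.
move=> abt ff fx; have [fx0|fx0] := boolP (0 <= coord (f x))%R.
  by exists f; split=> //; exact: near_refl.
exists (f * h2_sigma); split; [exact: framed_sigma | | exact: near_sigma].
by rewrite /= coord_sigma; case: ifP; lia.
Qed.

(** The cursor moves to the last gap of the block and never leaves the item [x]
behind. At that gap only one cell of the block is on its right, so that [x] ends
there, which is where it belongs. The cursor visits n + 1 gaps, with n steps and at
most n + 1 swaps. *)
Lemma sweep_right n a b t f x :
  (a + t < 0)%R -> (b + t = n.+1%:Z)%R -> framed a b t f ->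
  coord x = (b - 1)%R -> (-1 <= coord (f x))%R ->
  exists2 g, framed a (b - 1) (1 - b) g & near f g n.*2.+1.
Proof.
elim: n t f => [|n IH] t f at0 btn ff xb fx.
all: have [|f' [ff' f'x nf']] := swap_right _ ff fx; first lia.
all: have /(framed_inside ff') f'xI : (a <= coord x < b)%R by lia.
- exists f' => // p pab.
  have -> : (1 - b = t)%R by lia.
  have [px|px] := eqVneq p x; first by rewrite px; lia.
  have : coord p != coord x by apply: contra px => /eqP/coord_inj->.
  by move=> pxc; apply: ff'; lia.
have [|||||g fg ng] := IH (t - 1)%R (f' * h2_s^-1).
- lia.
- lia.
- exact: framed_sV.
- by [].
- by rewrite /= coord_unshift; lia.
exists g => //; rewrite doubleS.
exact: near_trans nf' (near_trans (near_sV _) ng).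
Qed.

Lemma framed_id f : framed (-1) 0 0 f -> f = 1.
Proof.
move=> ff; apply: h2P => p; apply: coord_inj => /=.
have [/eqP p1|p1] := boolP (coord p == -1)%R; last by rewrite ff ?addr0 //; lia.
by have := framed_inside (p := p) ff ltac:(lia); lia.
Qed.

(** A round of two sweeps, one in each direction, and two adjusting steps reduces
a block of 2j + 2 items to the inner 2j items, with the cursor again at the first
gap. The bound is 2N - 1, where N = (j + 1)(2j + 1) is the number of gaps visited. *)
Lemma collapse j f : framed (- j.+1%:Z) j.+1%:Z j%:Z f ->
  near f 1 (4 * j ^ 2 + 6 * j + 1).
Proof.
elim: j f => [|j IH] f ff.
  have [|||||g fg ng] := @sweep_right 0 (-1) 1 0 f (0, true) => //.
    by have := framed_inside (p := (0, true)) ff erefl; lia.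
  by rewrite -(framed_id fg).
have [||||g fg ng] := @sweep_right j.*2.+2 _ _ _ f (j.+1, true) _ _ ff.
- lia.
- lia.
- by rewrite coordE; lia.
- by have := framed_inside (p := (j.+1, true)) ff ltac:(rewrite coordE; lia); lia.
(* the right end is now fixed; the second sweep is to the left *)
have gs := framed_mirror (framed_s fg).
have [||||h fh nh] := @sweep_right j.*2.+1 _ _ _ _ (j.+1, true) _ _ gs.
- lia.
- lia.
- by rewrite coordE; lia.
- by have := framed_inside (p := (j.+1, true)) gs ltac:(rewrite coordE; lia); lia.
have hs := framed_sV (framed_mirror fh).
have /IH nh1 : framed (- j.+1%:Z) j.+1%:Z j%:Z (mirror h * h2_s^-1).
  by congr (framed _ _ _ _) : hs; lia.
move/near_mirror: nh; rewrite mirrorK => nh.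
have := near_trans (near_trans ng (near_s g))
  (near_trans nh (near_trans (near_sV _) nh1)).
by apply: near_leq; nia.
Qed.

Lemma framed_shift d a b t f : framed a b t f ->
  exists2 g, framed a b (t + d%:Z) g & near f g d.
Proof.
move=> ff; elim: d => [|d [g fg ng]].
  by exists f; [rewrite addr0 | exact: near_refl].
exists (g * h2_s); last by rewrite -addn1; exact: near_trans ng (near_s g).
by have := framed_s fg; rewrite -addrA -addn1 PoszD.
Qed.

(** By reflection the cursor is at or to the left of the middle. It goes on to the
first gap of the block, or returns to it when it stands just outside (t = k). *)
Lemma framed_near1 k t f : (1 < k)%N -> (`|t| <= k%:Z)%R ->
  framed (- k%:Z) k%:Z t f -> near f 1 (4 * k ^ 2 - k - 2).
Proof.
move=> k1; wlog t0 : t f / (0 <= t)%R => [H|] tk ff.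
  have [t0|t0] := boolP (0 <= t)%R; first exact: H ff.
  have /near_mirror : near (mirror f) 1 (4 * k ^ 2 - k - 2).
    apply: (H (- t)%R); [lia | lia |].
    by have := framed_mirror ff; rewrite opprK.
  by rewrite mirrorK mirror1.
case: k k1 tk ff => // j j1 tj ff.
have [/eqP tE|tE] := boolP (t == j.+1%:Z)%R.
  have /collapse nf : framed (- j.+1%:Z) j.+1%:Z j%:Z (f * h2_s^-1).
    by congr (framed _ _ _ _) : (framed_sV ff); lia.
  by apply: near_leq (near_trans (near_sV f) nf); nia.
have [d dE] : exists d : nat, (t + d%:Z = j%:Z)%R by exists (absz (j%:Z - t)%R); lia.
have [g + fg] := framed_shift d ff; rewrite dE => /collapse g1.
by apply: near_leq (near_trans fg g1); nia.
Qed.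

(** A swap at the edge of the block would take [k] steps first, leaving no letter
for the swap itself. *)
Lemma trail_framed k g h t n : framed (- k%:Z) k%:Z 0 g -> trail g h t n ->
  (n <= k)%N -> (`|t| <= n%:Z)%R /\ framed (- k%:Z) k%:Z t h.
Proof.
move=> fg; elim=> [|h' u m _ IH|h' u m _ IH|h' u m _ IH] mk; first by [].
all: have [um fh] := IH (ltnW mk); split; first lia.
- exact: framed_s.
- exact: framed_sV.
- by apply: framed_sigma fh; lia.
Qed.

Lemma flip_framed k : framed (- k%:Z) k%:Z 0 (h2_flip k).
Proof. by move=> p pk; rewrite /= coord_flip addr0; case: ifP => //; lia. Qed.

Lemma near_flip k h : (1 < k)%N -> near (h2_flip k) h k ->
  near 1 h (4 * k ^ 2 - k - 2).
Proof.
move=> k1 [t [m [gh mk]]]; have [tm fh] := trail_framed (@flip_framed k) gh mk.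
by apply: near_sym; apply: framed_near1 fh => //; lia.
Qed.

(** * Inversions and cursor passages *)

(** The two cells beside the cursor have the same level, 0, so that swapping them
is not seen. A shift raises every level by one, except for the item that passes
the cursor. *)
Definition level (p : point) : int := (if p.2 then p.1%:Z else - p.1%:Z)%R.

Lemma level_sigma p : level (sigma_fun p) = level p.
Proof. by case: p => [[|i] []]. Qed.

Lemma level_shift p :
  level (shift_fun p) = (level p + 1 - (p == (0, false))%:Z)%R.
Proof. by case: p => [[|i] []]; rewrite /level /=; lia. Qed.

Lemma level_unshift p :
  level (shift_inv p) = (level p - 1 + (p == (0, true))%:Z)%R.
Proof. by case: p => [[|i] []]; rewrite /level /=; lia. Qed.

Section Potential.
Variables (I : finType) (e : I -> point).
Hypothesis e_inj : injective e.

Definition inverted (f : H2) (i j : I) : bool :=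
  (coord (e i) < coord (e j))%R && (coord (f (e j)) < coord (f (e i)))%R.

Definition inversions (f : H2) : int :=
  (\sum_(u : I * I) (inverted f u.1 u.2)%:Z)%R.

(** Each summand is the absolute value of the signed number of times that the item
is passed by the cursor on the way from [g] to [h], for words of net shift [t]. *)
Definition displacement (g h : H2) (t : int) : int :=
  (\sum_(i : I) `|level (h (e i)) - level (g (e i)) - t|)%R.

Lemma sum_at_most_one (J : finType) (P : pred J) :
  (forall i j, P i -> P j -> i = j) -> (\sum_(i : J) (P i)%:Z <= 1)%R.
Proof.
move=> P1; have [i Pi|P0] := pickP P.
  rewrite (bigD1 i) //= big1 ?addr0 ?Pi // => j ji.
  by case Pj: (P j) => //; rewrite (P1 _ _ Pj Pi) eqxx in ji.
by rewrite big1 // => i _; rewrite P0.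
Qed.

Lemma sum_hits_le1 (h : H2) (p : point) :
  (\sum_(i : I) (h (e i) == p)%:Z <= 1)%R.
Proof.
by apply: sum_at_most_one => i j /eqP hi /eqP hj; apply/e_inj/(@h2_inj h); rewrite hi.
Qed.

Lemma displacement_triangle f g h t u :
  (displacement f h (t + u) <= displacement f g t + displacement g h u)%R.
Proof.
by rewrite /displacement -big_split ler_sum // => i _ /=; lia.
Qed.

Lemma inversions_s h : inversions (h * h2_s) = inversions h.
Proof.
by apply: eq_bigr => u _; rewrite /inverted /= !coord_shift ltrD2r.
Qed.

Lemma inversions_sV h : inversions (h * h2_s^-1) = inversions h.
Proof. by rewrite -[in RHS](mulgVK h2_s h) inversions_s. Qed.

(** The only pair whose order can change is the one in the two cells beside the
cursor. *)
Lemma inversions_sigma h : (inversions (h * h2_sigma) <= inversions h + 1)%R.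
Proof.
pose P (u : I * I) := (h (e u.1) == (0, false)) && (h (e u.2) == (0, true)).
have P1 : (\sum_(u : I * I) (P u)%:Z <= 1)%R.
  apply: sum_at_most_one => -[i j] [i' j'] /andP[/= /eqP hi /eqP hj].
  move=> /andP[/= /eqP hi' /eqP hj'].
  by congr pair; apply/e_inj/(@h2_inj h); rewrite ?hi ?hj.
apply: le_trans (lerD (lexx _) P1); rewrite /inversions -big_split ler_sum //= => u _.
rewrite /inverted /P /= !coord_sigma -!(inj_eq coord_inj) !coordE.
by do 2!case: ifP; lia.
Qed.

(** Swaps pay for inversions and cursor steps pay for passages, one unit each. *)
Lemma trail_potential g h t n : trail g h t n ->
  (inversions h + displacement g h t <= inversions g + n%:Z)%R.
Proof.
elim=> [|h' u m _ IH|h' u m _ IH|h' u m _ IH].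
- by rewrite /displacement big1 ?addr0 // => i _; rewrite subrr subr0.
- have := displacement_triangle g h' (h' * h2_s) u 1.
  have : (displacement h' (h' * h2_s) 1 <= 1)%R.
    apply: le_trans (sum_hits_le1 h' (0, false)); rewrite ler_sum // => i _ /=.
    by rewrite level_shift; case: (_ == _); lia.
  by rewrite inversions_s; lia.
- have := displacement_triangle g h' (h' * h2_s^-1) u (-1).
  have : (displacement h' (h' * h2_s^-1) (-1) <= 1)%R.
    apply: le_trans (sum_hits_le1 h' (0, true)); rewrite ler_sum // => i _ /=.
    by rewrite level_unshift; case: (_ == _); lia.
  by rewrite inversions_sV; lia.
- have := displacement_triangle g h' (h' * h2_sigma) u 0.
  have : (displacement h' (h' * h2_sigma) 0 = 0)%R.
    by apply: big1 => i _ /=; rewrite level_sigma subrr subr0.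
  have := inversions_sigma h'.
  by rewrite addr0; lia.
Qed.

End Potential.

(** * The first visit to the end of the block *)

(** Before the cursor has moved [m] steps to the left along the items, no swap can
reach the items of coordinate less than -m; they have only been shifted. *)
Lemma trail_first_hit m h t n : (0 < m)%N -> trail 1 h t n ->
  [/\ (t < m%:Z)%R &
       forall p, (coord p < - m%:Z)%R -> coord (h p) = (coord p + t)%R]
  \/ exists f n1 n2, [/\ trail 1 f m n1, trail f h (t - m%:Z)%R n2,
       n = (n1 + n2)%N &
       forall p, (coord p < - m%:Z)%R -> coord (f p) = (coord p + m%:Z)%R].
Proof.
move=> m0; elim=> [|h' u r ht IH|h' u r ht IH|h' u r ht IH].
- by left; split=> // p _; rewrite addr0.
- case: IH => [[um hl]|[f [n1 [n2 [ff fh -> fl]]]]]; last first.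
    right; exists f, n1, n2.+1; split=> //; last by rewrite addnS.
    by rewrite addrAC; exact: trail_s.
  have hl' p : (coord p < - m%:Z)%R -> coord ((h' * h2_s) p) = (coord p + (u + 1))%R.
    by move=> /hl /= hp; rewrite coord_shift hp addrA.
  have [/eqP uE|uE] := boolP (u + 1 == m%:Z)%R; last by left; split=> //; lia.
  right; exists (h' * h2_s), r.+1, 0%N; rewrite -uE; split; rewrite ?addn0 ?uE -?uE //.
  + exact: trail_s.
  + by rewrite subrr; constructor.
  + by rewrite uE in hl' *.
- case: IH => [[um hl]|[f [n1 [n2 [ff fh -> fl]]]]].
    left; split=> [|p /hl /= hp]; first lia.
    by rewrite coord_unshift hp addrA.
  right; exists f, n1, n2.+1; split=> //; last by rewrite addnS.
  by rewrite addrAC; exact: trail_sV.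
- case: IH => [[um hl]|[f [n1 [n2 [ff fh -> fl]]]]].
    left; split=> // p pm; have /= hp := hl _ pm.
    by rewrite coord_sigma hp; case: ifP => //; lia.
  right; exists f, n1, n2.+1; split=> //; last by rewrite addnS.
  exact: trail_sigma.
Qed.

(** For q > 0 only 2q - 1 integers have absolute value less than q. *)
Lemma large_entry (s : seq int) : uniq s -> s != [::] ->
  exists2 x, x \in s & ((size s)./2%:Z <= `|x|)%R.
Proof.
move=> us s0; set q := (size s)./2.
have [/hasP//|/hasPn small] := boolP (has (fun x : int => q%:Z <= `|x|)%R s).
have sub : {subset s <= [seq (i%:Z - (q.-1)%:Z)%R | i <- iota 0 (q.*2.-1)]}.
  move=> x /small xq; apply/mapP; exists (absz (x + (q.-1)%:Z)%R); last by lia.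
  by rewrite mem_iota; lia.
have := uniq_leq_size us sub; rewrite size_map size_iota.
have : size s != 0%N by case: (s) s0.
move=> n0 nq; exfalso; move: nq n0; rewrite /q; clear.
move: (size s) => n; have := odd_double_half n.
by case: odd; lia.
Qed.

(** Removing a large entry repeatedly gives the sum of the numbers i/2 (rounded
down) for i up to [size s]; the closed form covers both parities. *)
Lemma sum_abs_uniq (s : seq int) : uniq s ->
  (((size s)./2 * (size s).-1./2 + (size s)./2)%:Z <= \sum_(x <- s) `|x|)%R.
Proof.
have [n] := ubnP (size s); elim: n s => // n IH s sn us.
have [->|s0] := eqVneq s [::]; first by rewrite big_nil.
have [x xs xl] := large_entry us s0.
have := IH (rem x s) _ (rem_uniq x us); rewrite size_rem //.
rewrite (big_rem x xs) /=; set S := (X in (_ + X)%R).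
have S0 : (0 <= S)%R by apply: sumr_ge0.
case: (size s) xl sn => [|r] xl sn /=; first lia.
move=> /(_ ltac:(lia)) H.
have : (uphalf r * r./2 + uphalf r <= r./2 * r.-1./2 + r./2 + uphalf r)%N.
  by case: (r) => //= r'; rewrite uphalf_half; case: odd; lia.
by move=> half_le; apply: le_trans (lerD xl H); lia.
Qed.

Lemma sum_abs_inj (J : finType) (a : J -> int) m : injective a -> #|J| = m.*2 ->
  ((m * m)%:Z <= \sum_(j : J) `|a j|)%R.
Proof.
move=> a_inj Jm; have us : uniq (codom a) by rewrite map_inj_uniq ?enum_uniq.
have := sum_abs_uniq us; rewrite size_codom Jm big_image /=; apply: le_trans.
by case: m {Jm} => // m; rewrite doubleS /= uphalf_double doubleK; lia.
Qed.

Lemma sum_lt_inj (J : finType) (a : J -> int) m : injective a -> #|J| = m.+1.*2 ->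
  (\sum_(u : J * J) (a u.1 < a u.2)%R%:Z = ((m.+1 * m.*2.+1)%N)%:Z)%R.
Proof.
move=> a_inj Jm; set S := (LHS).
have S1 : S = (\sum_i \sum_j (a i < a j)%R%:Z)%R by rewrite pair_bigA.
have : (S + S = \sum_(i : J) \sum_(j : J | j != i) 1)%R.
  rewrite {2}S1 exchange_big S1 -big_split /=; apply: eq_bigr => i _.
  rewrite -big_split [RHS]big_mkcond /=; apply: eq_bigr => j _.
  have [->|ji] := eqVneq j i; first by rewrite ltxx.
  by rewrite -(inj_eq a_inj) in ji; case: (ltgtP (a j) (a i)) ji.
under eq_bigr => i _ do rewrite sumr_const cardC1 Jm.
by rewrite sumr_const Jm; nia.
Qed.

Definition block m (u : 'I_m.+1 * bool) : point := (val u.1, u.2).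

Lemma block_inj m : injective (@block m).
Proof. by move=> [i b] [j c] [/val_inj-> ->]. Qed.

Lemma inversions1 m : inversions (@block m) 1 = 0%R.
Proof.
by apply: big1 => u _; rewrite /inverted /=; case: ltgtP.
Qed.

Lemma inversions_flip m :
  inversions (@block m) (h2_flip m.+1) = Posz (m.+1 * m.*2.+1).
Proof.
have c_inj := inj_comp coord_inj (@block_inj m).
rewrite -(sum_lt_inj c_inj) ?card_prod ?card_ord ?card_bool; last by lia.
apply: eq_bigr => -[[i b] [j c]] _; rewrite /inverted /= !coord_flip /block !coordE /=.
have := ltn_ord i; have := ltn_ord j.
by case: b; case: c; do 2!case: ifP; lia.
Qed.

(** The cells to the left of the cursor are all filled by the items of coordinate
less than -m. *)
Lemma right_of_hit m (f : H2) (p : point) :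
  (forall q, (coord q < - m%:Z)%R -> coord (f q) = (coord q + m%:Z)%R) ->
  (- m%:Z <= coord p)%R -> (0 <= coord (f p))%R.
Proof.
move=> fl pm; apply: contraT => fp.
have := fl (of_coord (coord (f p) - m%:Z)%R); rewrite of_coordK subrK => fq.
have /coord_inj/(@h2_inj f) pE := fq ltac:(lia).
by move: pm; rewrite -pE of_coordK; lia.
Qed.

(** Let x be [level (f p) - m] and y be [level p]; the flip turns y into -y. Then
the item [p] is passed at least |x - y| + |x + y| times, which is at least 2|x| and at
least 2|y|. The first bound is used for the inner items, whose x are distinct, and
the second one for the two extreme items, with |y| = m. *)
Lemma displacement_via_hit m (f : H2) :
  (forall p, (coord p < - m%:Z)%R -> coord (f p) = (coord p + m%:Z)%R) ->
  (Posz (2 * m ^ 2 + 4 * m) <= displacement (@block m) 1 f m%:Z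
     + displacement (@block m) f (h2_flip m.+1) (- m%:Z))%R.
Proof.
move=> fl; rewrite /displacement -big_split /=.
under eq_bigr => u _.
  have -> : level (flip_fun m.+1 (block u)) = (- level (block u))%R.
    by rewrite /flip_fun /block /= ltn_ord /level /=; case: (u.2) => //=; rewrite opprK.
  over.
rewrite -(pair_bigA _ (fun i b =>
   `|level (f (block (i, b))) - level (block (i, b)) - m%:Z|
   + `|- level (block (i, b)) - level (f (block (i, b))) - - m%:Z|)%R) /=.
(* the last index gives the two extreme items *)
rewrite big_ord_recr /= big_bool.
pose a (u : 'I_m * bool) : int := (level (f (val u.1, u.2)) - m%:Z)%R.
have a_inj : injective a.
  have level_coord (w : 'I_m * bool) :
      level (f (val w.1, w.2)) = coord (f (val w.1, w.2)).
    have : (0 <= coord (f (val w.1, w.2)))%R.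
      apply: (right_of_hit fl); rewrite coordE; have := ltn_ord w.1.
      by case: w => i [] /=; lia.
    by case: (f _) => i [].
  move=> u v /addIr; rewrite !level_coord => /coord_inj/(@h2_inj f).
  by case: u v => [i b] [j c] [/val_inj-> ->].
have := sum_abs_inj a_inj (m := m); rewrite card_prod card_ord card_bool muln2.
rewrite -(pair_bigA _ (fun i b => `|a (i, b)|)%R) /= => /(_ erefl) Ha.
set A := (X in (X + _)%R); have : (2 * (\sum_(i < m) \sum_b `|a (i, b)|) <= A)%R.
  rewrite mulr_sumr ler_sum // => i _; rewrite mulr_sumr ler_sum // => b _.
  by rewrite /a /block /=; lia.
rewrite /block /= -mulnn; move: A => A HA.
have -> : level (m, true) = Posz m by [].
have -> : level (m, false) = (- m%:Z)%R by [].
move: (level _) (level _) Ha HA => x y; move: (\sum_(i < m) _)%R => B.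
by lia.
Qed.

(** For k = m + 1 the bound 4m^2 + 7m + 1 equals 4k^2 - k - 2. *)
Lemma trail_flip_lower m t n : (0 < m)%N -> trail 1 (h2_flip m.+1) t n ->
  (4 * m ^ 2 + 7 * m + 1 <= n)%N.
Proof.
move=> m0 gt.
have t0 : t = 0%R.
  (* a point that no word of length n can rearrange reveals the net shift *)
  have f1 : framed (- n%:Z) n%:Z 0 1 by move=> p _; rewrite addr0.
  have [_ fg] := trail_framed f1 gt (leqnn n).
  have := fg (maxn n m.+1, true); rewrite /= coord_flip !coordE.
  by case: ifP; lia.
(* without a visit to the end gap, the item (m, false) would only be shifted, by
   t < m, whereas the flip moves it by 2m + 1 *)
case: (trail_first_hit m0 gt) => [[_ /(_ (m, false))]|].
  by rewrite /= coord_flip coordE; case: ifP; lia.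
move=> [f [n1 [n2 [h1 h2 -> fl]]]].
have := trail_potential (@block_inj m) h1; have := trail_potential (@block_inj m) h2.
have := displacement_via_hit fl.
by rewrite t0 add0r inversions1 inversions_flip; lia.
Qed.

(** * The flip is a deep dead end *)

Lemma flip_dist k : (1 < k)%N ->
  cayley_dist h2_gens 1 (h2_flip k) (4 * k ^ 2 - k - 2).
Proof.
case: k => // k k0.
have low n : cayley_walk h2_gens 1 (h2_flip k.+1) n -> (4 * k.+1 ^ 2 - k.+1 - 2 <= n)%N.
  by case/cayley_walkP=> t /(trail_flip_lower k0); nia.
split=> //; have [t [n [gt nle]]] := near_flip k0 (near_refl (h2_flip k.+1) k.+1).
have W : cayley_walk h2_gens 1 (h2_flip k.+1) n by apply/cayley_walkP; exists t.
by have -> : (4 * k.+1 ^ 2 - k.+1 - 2 = n)%N by apply/eqP; rewrite eqn_leq low.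
Qed.

(** The depth is finite: following the flip by the l-th power of the shift moves a
far point by [l]. *)
Lemma ball_depth_bounded k n l :
  classical_sets.subset (cayley_ball h2_gens (h2_flip k) l) (cayley_ball h2_gens 1 n) ->
  (l <= n)%N.
Proof.
have [g fg gl] := framed_shift l (@flip_framed k).
move=> sub; have /ballP[t [m [gt mn]]] := sub _ (proj2 (ballP _ _ _) gl).
have := trail_dist (k, true) gt; rewrite fg; last by rewrite coordE; lia.
by rewrite /= coordE; lia.
Qed.

Theorem theorem6 (k : nat) (hk : (1 < k)%N) :
  dead_end h2_gens (h2_flip k) /\
  exists2 l : nat, depth_is h2_gens (h2_flip k) l & (k <= l)%N.
Proof.
have D := flip_dist hk.
have sub l : (l <= k)%N -> classical_sets.subset (cayley_ball h2_gens (h2_flip k) l)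
    (cayley_ball h2_gens 1 (4 * k ^ 2 - k - 2)).
  by move=> lk h /ballP/(near_leq lk)/(near_flip hk) ?; apply/ballP.
split; first by exists (4 * k ^ 2 - k - 2)%N => //; apply: sub; exact: ltnW.
pose Q l := `[< classical_sets.subset (cayley_ball h2_gens (h2_flip k) l)
    (cayley_ball h2_gens 1 (4 * k ^ 2 - k - 2)) >].
have exQ : exists l, Q l by exists k; apply/asboolP/sub.
have boundQ l : Q l -> (l <= 4 * k ^ 2 - k - 2)%N by move/asboolP/ball_depth_bounded.
have [l /asboolP Ql maxl] := ex_maxnP exQ boundQ.
exists l; last by apply/maxl/asboolP/sub.
by exists (4 * k ^ 2 - k - 2)%N; split=> // l' ?; apply/maxl/asboolP.
Qed.
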